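(* Let $d=q=1$ and consider the recursive marginal quantization $(\widetilde X_k)_{0\le k\le n}$, $(\widehat X_k)_{0\le k\le n}$ of the Euler scheme with coefficients $b,\sigma$, as described in the context. Let $k\in\{0,\dots,n-1\}$, let $\Gamma_k=(x^k_1,\dots,x^k_{N_k})$ be a quadratic optimal quantizer for $\widetilde X_k$ with weights $p^k_i=\mathbb P(\widetilde X_k\in C_i(\Gamma_k))$, $i=1,\dots,N_k$, and let $\Gamma_{k+1}=(x^{k+1}_1,\dots,x^{k+1}_{N_{k+1}})$ be a quadratic optimal quantizer for $\widetilde X_{k+1}$. Then, with $x^{k+1}_{j\pm}(\cdot)$ as defined in the context: 1. for every $i=1,\dots,N_k$ and $j=1,\dots,N_{k+1}$, the transition probability $p^k_{ij}=\mathbb P\big(\widetilde X_{k+1}\in C_j(\Gamma_{k+1})\,\big|\,\widetilde X_k\in C_i(\Gamma_k)\big)$ is given by $$p^k_{ij}=\Phi_0\big(x^{k+1}_{j+}(x^k_i)\big)-\Phi_0\big(x^{k+1}_{j-}(x^k_i)\big);$$ 2. for every $j=1,\dots,N_{k+1}$, the probability $p^{k+1}_j=\mathbb P\big(\widetilde X_{k+1}\in C_j(\Gamma_{k+1})\big)$ is given by $$p^{k+1}_j=\sum_{i=1}^{N_k}p^k_i\Big(\Phi_0\big(x^{k+1}_{j+}(x^k_i)\big)-\Phi_0\big(x^{k+1}_{j-}(x^k_i)\big)\Big).$$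
   Context: Let $T>0$, $n\ge1$, $\Delta=T/n$, $t_k=k\Delta$. The functions $b,\sigma:[0,T]\times\mathbb R\to\mathbb R$ are measurable, Lipschitz in the space variable uniformly in $t\in[0,T]$, with $b(\cdot,0),\sigma(\cdot,0)$ bounded on $[0,T]$, and $\sigma\sigma^\star(t,x)=\sigma(t,x)^2$ is invertible (i.e. nonzero) for all $(t,x)\in[0,T]\times\mathbb R$. Write $b_k(x)=b(t_k,x)$, $\sigma_k(x)=\sigma(t_k,x)$, and $\mathcal E_k(x,z)=x+\Delta b_k(x)+\sqrt\Delta\,\sigma_k(x)z$. Let $X_0$ be a square-integrable real random variable and $(Z_k)_{k=1,\dots,n}$ an i.i.d. sequence of $\mathcal N(0;1)$ random variables independent of $X_0$. The recursive marginal quantization is defined by $\widetilde X_0=X_0$, $\widehat X_k=\mathrm{Proj}_{\Gamma_k}(\widetilde X_k)$ for $k=0,\dots,n$ and $\widetilde X_{k+1}=\mathcal E_k(\widehat X_k,Z_{k+1})$ for $k=0,\dots,n-1$, where each $\Gamma_k$ is a quadratic optimal quantizer for $\widetilde X_k$ at level $N_k$, i.e. a subset of $\mathbb R$ of cardinality at most $N_k$ minimizing $\mathbb E[\mathrm{dist}(\widetilde X_k,\Gamma)^2]$ among all such sets. The grids are taken of full size $N_k$ and identified with the tuple $(x^k_1,\dots,x^k_{N_k})$ of their elements in increasing order. $(C_i(\Gamma_k))_{i=1,\dots,N_k}$ is the Borel Voronoi partition of $\mathbb R$ associated with $\Gamma_k$: $C_i(\Gamma_k)\subset\{x:|x-x^k_i|=\min_{j}|x-x^k_j|\}$,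 and $\mathrm{Proj}_{\Gamma_k}=\sum_i x^k_i\mathbf 1_{C_i(\Gamma_k)}$ is the corresponding nearest neighbour projection, so that $\{\widehat X_k=x^k_i\}=\{\widetilde X_k\in C_i(\Gamma_k)\}$. Conditional probabilities given $\{\widetilde X_k\in C_i(\Gamma_k)\}$ are understood for cells of positive probability. $\Phi_0$ is the cumulative distribution function of $\mathcal N(0;1)$, with $\Phi_0(-\infty)=0$, $\Phi_0(+\infty)=1$. For $j=1,\dots,N_{k+1}$ set $x^{k+1}_{j-1/2}=\frac{x^{k+1}_j+x^{k+1}_{j-1}}2$ and $x^{k+1}_{j+1/2}=\frac{x^{k+1}_j+x^{k+1}_{j+1}}2$, with $x^{k+1}_{1/2}=-\infty$ and $x^{k+1}_{N_{k+1}+1/2}=+\infty$. For $\xi\in\mathbb R$ set $m_k(\xi)=\xi+\Delta b_k(\xi)$, $v_k(\xi)=\sqrt\Delta\,\sigma_k(\xi)$, and $$x^{k+1}_{j-}(\xi)=\frac{x^{k+1}_{j-1/2}-m_k(\xi)}{v_k(\xi)},\qquad x^{k+1}_{j+}(\xi)=\frac{x^{k+1}_{j+1/2}-m_k(\xi)}{v_k(\xi)}.$$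
   Formalization: The displayed formulas hold when σ_k > 0; when σ_k < 0 (also allowed by the assumptions) their right-hand sides are ≤ 0, so there they are proved with Φ_0(x_{j+}) and Φ_0(x_{j−}) exchanged. As σ_k is continuous and nonzero, these two cases are exhaustive. *)

(* Defs.v *)
From HB Require Import structures.
From mathcomp Require Export all_boot all_order all_algebra.
From mathcomp Require Export all_classical all_reals all_analysis.
Set Implicit Arguments.
Unset Strict Implicit.
Unset Printing Implicit Defensive.
Export Order.TTheory GRing.Theory Num.Theory.
Export numFieldNormedType.Exports.
Local Open Scope classical_set_scope.
Local Open Scope ring_scope.

Section probability_notions.
Context {d : measure_display} {T : measurableType d} {R : realType}.
Variable P : probability T R.

Definition cond_prob (A B : set T) : R := fine (P (A `&` B)) / fine (P B).

(* Mutual independence of the subfamily (Z i), i in D: product rule over all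
   finite subfamilies. *)
Definition mutually_independent (D : set nat) (Z : nat -> {RV P >-> R}) : Prop :=
  forall (s : seq nat) (B : nat -> set R),
    uniq s -> [set` s] `<=` D -> (forall i, measurable (B i)) ->
    P (\bigcap_(i in [set` s]) (Z i @^-1` B i)) =
      (\prod_(i <- s) P (Z i @^-1` B i))%E.

Definition sigma_of_family (D : set nat) (Z : nat -> {RV P >-> R}) :
    set (set T) :=
  <<s [set E | exists i B, [/\ D i, measurable B & E = Z i @^-1` B]] >>.

(* X is independent of the whole family (Z i), i in D, not merely of each
   member. *)
Definition independent_of_family (X : {RV P >-> R})
    (D : set nat) (Z : nat -> {RV P >-> R}) : Prop :=
  forall (A : set R) (E : set T),
    measurable A -> sigma_of_family D Z E ->
    P ((X @^-1` A) `&` E) = (P (X @^-1` A) * P E)%E.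

End probability_notions.

Section quantization.
Context {R : realType}.

(* The infimum is 0 when A is empty; only nonempty A are used below. *)
Definition dist_to (A : set R) (y : R) : R := inf [set `|y - a| | a in A].

Definition distortion {d : measure_display} {T : measurableType d}
    (P : probability T R) (X : T -> R) (A : set R) : \bar R :=
  ('E_P[fun w => (dist_to A (X w) ^+ 2)%R])%E.

Definition optimal_quantizer {d : measure_display} {T : measurableType d}
    (P : probability T R) (X : T -> R) (N : nat) (A : set R) : Prop :=
  [/\ A !=set0, (A #<= `I_N)%card
    & forall B : set R, B !=set0 -> (B #<= `I_N)%card ->
        (distortion P X A <= distortion P X B)%E].

Definition voronoi_partition (N : nat) (x : N.-tuple R) (C : 'I_N -> set R) :
    Prop :=
  [/\ forall i, measurable (C i),
      trivIset setT C,
      \bigcup_i C i = setT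
    & forall i, C i `<=`
        [set y | forall j, `|y - tnth x i| <= `|y - tnth x j|]].

Definition proj_grid (N : nat) (x : N.-tuple R) (C : 'I_N -> set R) (y : R) :
    R := \sum_(i < N) tnth x i * \1_(C i) y.

(* Endpoints x_{j-1/2} and x_{j+1/2} of the j-th cell; the indices of x start
   at 0. *)
Definition lower_mid (N : nat) (x : N.-tuple R) (j : 'I_N) : \bar R :=
  if (j == 0 :> nat)%N then -oo%E else ((x`_j + x`_j.-1) / 2)%:E.

Definition upper_mid (N : nat) (x : N.-tuple R) (j : 'I_N) : \bar R :=
  if (j.+1 == N)%N then +oo%E else ((x`_j + x`_j.+1) / 2)%:E.

Definition Phi0 (y : \bar R) : R :=
  match y with
  | r%:E => fine (normal_prob (0 : R) 1 `]-oo, r])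
  | +oo%E => 1
  | -oo%E => 0
  end.

End quantization.

Section euler_scheme.
Context {R : realType}.

(* Standing assumptions on a coefficient f : [0, hor] x R -> R; the values of
   f outside of [0, hor] x R are irrelevant. *)
Definition euler_coefficient (hor : R) (f : R -> R -> R) : Prop :=
  [/\ measurable_fun (`[0, hor] `*` [set: R]) (fun tx : R * R => f tx.1 tx.2),
      exists L : R, forall t, t \in `[0, hor] ->
        forall y z, `|f t y - f t z| <= L * `|y - z|
    & exists M : R, forall t, t \in `[0, hor] -> `|f t 0| <= M].

(* D is the time step and k * D the k-th discretization time. *)
Definition euler_mean (D : R) (b : R -> R -> R) (k : nat) (xi : R) : R :=
  xi + D * b (k%:R * D) xi.

Definition euler_scale (D : R) (sigma : R -> R -> R) (k : nat) (xi : R) : R :=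
  Num.sqrt D * sigma (k%:R * D) xi.

Definition euler_op (D : R) (b sigma : R -> R -> R) (k : nat) (xi z : R) : R :=
  euler_mean D b k xi + euler_scale D sigma k xi * z.

Fixpoint Xtilde {T : Type} (D : R) (b sigma : R -> R -> R)
    (N : nat -> nat) (x : forall k, (N k).-tuple R)
    (C : forall k, 'I_(N k) -> set R)
    (X0 : T -> R) (Z : nat -> T -> R) (k : nat) (w : T) : R :=
  if k is k'.+1 then
    euler_op D b sigma k'
      (proj_grid (x k') (C k') (Xtilde D b sigma x C X0 Z k' w)) (Z k'.+1 w)
  else X0 w.

Definition x_minus (D : R) (b sigma : R -> R -> R) (k : nat)
    (N : nat) (x : N.-tuple R) (j : 'I_N) (xi : R) : \bar R :=
  ((lower_mid x j - (euler_mean D b k xi)%:E)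
     * ((euler_scale D sigma k xi)^-1)%:E)%E.

Definition x_plus (D : R) (b sigma : R -> R -> R) (k : nat)
    (N : nat) (x : N.-tuple R) (j : 'I_N) (xi : R) : \bar R :=
  ((upper_mid x j - (euler_mean D b k xi)%:E)
     * ((euler_scale D sigma k xi)^-1)%:E)%E.

End euler_scheme.

(* Main.v *)
Require Import Defs.
From mathcomp Require Import measurable_realfun lra.
Set Implicit Arguments.
Unset Strict Implicit.
Unset Printing Implicit Defensive.
Local Open Scope classical_set_scope.
Local Open Scope ring_scope.

(** Once the quantized state is known to be the grid point x_i, the next state
  is an affine function of the next noise alone, and this noise is independent
  of the quantized state. The joint probability of cell i at time k and cell j
  at time k+1 is therefore the probability of cell i times the Gaussian mass
  of the preimage of cell j under z |-> m_k(x_i) + v_k(x_i) z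
  ([Xtilde_step]); dividing by the probability of cell i gives the transition
  probability, and summing over i gives the law at time k+1
  ([transition_formulas]).

  Two facts support this. The first is the independence of the state at time l
  from the noises of the later times ([Xtilde_indep]). The sigma-algebra
  generated by the past is never needed: splitting according to the finitely
  many cells at time l turns an event about the state at time l+1 into events
  about the state at time l and the noise l+1, so that the product rule goes by
  induction on l, provided that it is stated for all finite families of later
  noises at once.

  The second is the Gaussian mass of the preimage of a cell. On the line a
  Voronoi cell lies between the closed and the open interval bounded by the
  midpoints with its neighbours ([voronoi_cell_sub], [sub_voronoi_cell]); which
  of the endpoints it owns is irrelevant, as the normal law has no atoms
  ([gauss_between]). The affine map preserves the order of the endpoints if
  v_k > 0 and exchanges them if v_k < 0. *)

(** * Voronoi cells on the line *)

Section voronoi_cells.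
Context {R : realType} (N : nat) (x : N.-tuple R) (C : 'I_N -> set R).

Lemma lower_midE (j : 'I_N) (j0 : (0 < j)%N) :
  exists2 i : 'I_N, i.+1 = j & lower_mid x j = ((tnth x i + tnth x j) / 2)%:E.
Proof.
have iN : (j.-1 < N)%N by rewrite (leq_ltn_trans (leq_pred _)).
exists (Ordinal iN); first by rewrite /= prednK.
by rewrite /lower_mid gtn_eqF// !(tnth_nth 0)/= addrC.
Qed.

Lemma upper_midE (j : 'I_N) (jN : (j.+1 < N)%N) :
  exists2 i : 'I_N, j.+1 = i & upper_mid x j = ((tnth x j + tnth x i) / 2)%:E.
Proof.
exists (Ordinal jN) => //.
by rewrite /upper_mid ltn_eqF// !(tnth_nth 0)/=.
Qed.

Lemma closer_left (a c y : R) : a < c ->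
  (`|y - a| <= `|y - c|) = (y <= (a + c) / 2).
Proof.
move=> ac; rewrite -ler_sqr ?nnegrE// !real_normK ?num_real//.
by apply/idP/idP => h; nra.
Qed.

Lemma closer_right (a c y : R) : a < c ->
  (`|y - c| <= `|y - a|) = ((a + c) / 2 <= y).
Proof.
move=> ac; rewrite -ler_sqr ?nnegrE// !real_normK ?num_real//.
by apply/idP/idP => h; nra.
Qed.

Context (xs : sorted <%R x).

Lemma grid_le (i j : 'I_N) : (i <= j)%N -> tnth x i <= tnth x j.
Proof.
by move=> ij; rewrite !(tnth_nth 0) lt_sorted_leq_nth// inE size_tuple.
Qed.

Lemma grid_lt (i j : 'I_N) : (i < j)%N -> tnth x i < tnth x j.
Proof.
by move=> ij; rewrite !(tnth_nth 0) lt_sorted_ltn_nth// inE size_tuple.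
Qed.

Lemma lower_mid_le_upper_mid (j : 'I_N) : (lower_mid x j <= upper_mid x j)%E.
Proof.
have [j0|j0] := posnP j; first by rewrite /lower_mid j0 leNye.
have [jN|jN] := eqVneq j.+1 N; first by rewrite /upper_mid jN eqxx leey.
have [i ij ->] := lower_midE j0.
have [|h jh ->] := @upper_midE j; first by rewrite ltn_neqAle jN ltn_ord.
rewrite lee_fin ler_pM2r// addrC lerD2l.
by apply: grid_le; rewrite -jh -ij -addn2 leq_addr.
Qed.

Context (vor : voronoi_partition x C).

Lemma proj_grid_cell (i : 'I_N) (y : R) : C i y -> proj_grid x C y = tnth x i.
Proof.
case: vor => _ /trivIsetP tC _ _ Ciy; rewrite /proj_grid (bigD1 i)//= big1.
  by rewrite addr0 indicE mem_set// mulr1.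
move=> j ji; rewrite indicE memNset ?mulr0// => Cjy.
by have /seteqP[/(_ y) + _] := tC _ _ I I ji; apply.
Qed.

(** Comparing the distance to x_j with the distances to its two neighbours is
  enough here. *)
Lemma voronoi_cell_sub (j : 'I_N) (y : R) :
  C j y -> (lower_mid x j <= y%:E <= upper_mid x j)%E.
Proof.
case: vor => _ _ _ /(_ j y) sub /sub{}sub; apply/andP; split.
  have [j0|j0] := posnP j; first by rewrite /lower_mid j0 leNye.
  have [i ij ->] := lower_midE j0.
  by rewrite lee_fin -closer_right ?sub// grid_lt// -ij.
have [jN|jN] := eqVneq j.+1 N; first by rewrite /upper_mid jN eqxx leey.
have [|h jh ->] := @upper_midE j; first by rewrite ltn_neqAle jN ltn_ord.
by rewrite lee_fin -closer_left ?sub// grid_lt// -jh.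
Qed.

(** The cells cover the line, so it is enough that y lies in no other cell:
  a point of the cell of some x_i with i < j is at most (x_i + x_j) / 2, hence
  at most the lower midpoint of j, and symmetrically for i > j. *)
Lemma sub_voronoi_cell (j : 'I_N) (y : R) :
  (lower_mid x j < y%:E < upper_mid x j)%E -> C j y.
Proof.
move=> /andP[ly yu]; case: (vor) => _ _ CT closest.
have [i _ Ciy] : (\bigcup_i C i) y by rewrite CT.
have [ij|ji|/val_inj <-//] := ltngtP i j; have := closest i y Ciy j.
- have [|k kj lE] := @lower_midE j; first exact: leq_ltn_trans ij.
  move: ly; rewrite lE lte_fin => ly; rewrite closer_left ?grid_lt// leNgt.
  rewrite (le_lt_trans _ ly)// ler_pM2r// lerD2r grid_le//.
  by rewrite -ltnS kj.
- have [|k kj uE] := @upper_midE j; first exact: leq_ltn_trans ji _.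
  move: yu; rewrite uE lte_fin => yu; rewrite closer_right ?grid_lt// leNgt.
  rewrite (lt_le_trans yu)// ler_pM2r// lerD2l grid_le//.
  by rewrite -kj.
Qed.

End voronoi_cells.

(** * Gaussian mass of intervals *)

Section gaussian_intervals.
Context {R : realType}.
Local Notation gauss := (normal_prob (0 : R) 1).

Lemma gauss_set1 (a : R) : gauss [set a] = 0%E.
Proof.
have /null_content_dominatesP := normal_prob_dominates (0 : R) 1.
by apply; [exact: measurable_set1|exact: lebesgue_measure_set1].
Qed.

Lemma measurable_half_line (a : \bar R) :
  measurable [set z : R | (z%:E <= a)%E].
Proof.
case: a => [r||].
- rewrite (_ : [set _ | _] = `]-oo, r]%classic); first exact: measurable_itv.
  by apply/seteqP; split => z; rewrite /= in_itv/= lee_fin.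
- rewrite (_ : [set _ | _] = setT)//.
  by apply/seteqP; split => z //= _; rewrite leey.
- by rewrite (_ : [set _ | _] = set0)//; apply/seteqP; split.
Qed.

Lemma gauss_half_line (a : \bar R) :
  gauss [set z : R | (z%:E <= a)%E] = (Phi0 a)%:E.
Proof.
case: a => [r||].
- rewrite (_ : [set _ | _] = `]-oo, r]%classic).
    by rewrite fineK// fin_num_measure.
  by apply/seteqP; split => z; rewrite /= in_itv/= lee_fin.
- rewrite (_ : [set _ | _] = setT) ?probability_setT//.
  by apply/seteqP; split => z //= _; rewrite leey.
- by rewrite (_ : [set _ | _] = set0) ?measure0//; apply/seteqP; split.
Qed.

Lemma half_openE (a c : \bar R) :
  [set z : R | (a < z%:E <= c)%E] =
  [set z : R | (z%:E <= c)%E] `\` [set z : R | (z%:E <= a)%E].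
Proof.
apply/seteqP; split => z /=.
  by move=> /andP[az zc]; split=> //; apply/negP; rewrite -ltNge.
by move=> [-> /negP]; rewrite -ltNge => ->.
Qed.

Lemma measurable_half_open (a c : \bar R) :
  measurable [set z : R | (a < z%:E <= c)%E].
Proof.
by rewrite half_openE; apply: measurableD; exact: measurable_half_line.
Qed.

Lemma gauss_half_open (a c : \bar R) : (a <= c)%E ->
  gauss [set z : R | (a < z%:E <= c)%E] = (Phi0 c - Phi0 a)%:E.
Proof.
move=> ac; rewrite half_openE.
rewrite measureD/=; [|exact: measurable_half_line..|].
  rewrite setIidr ?gauss_half_line// => z /= za; exact: le_trans ac.
by rewrite gauss_half_line ltry.
Qed.

Lemma gauss_le_up_to_point (A S : set R) (r : R) :
  measurable A -> measurable S -> A `<=` S `|` [set r] ->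
  (gauss A <= gauss S)%E.
Proof.
move=> mA mS AS; rewrite -[leRHS]adde0 -(gauss_set1 r).
apply: le_trans (measureU2 _ _ _) => //.
by apply: le_measure; rewrite ?inE//; exact: measurableU.
Qed.

(** Such a set differs from the half-open interval by at most one point on
  either side. *)
Lemma gauss_between (a c : \bar R) (S : set R) :
  measurable S -> (a <= c)%E ->
  (forall z, (a < z%:E < c)%E -> S z) ->
  (forall z, S z -> (a <= z%:E <= c)%E) ->
  gauss S = (Phi0 c - Phi0 a)%:E.
Proof.
move=> mS ac inS Sin; rewrite -gauss_half_open//.
have mI := measurable_half_open a c.
(* When an endpoint is infinite no real number equals it, and the point
   fine a = 0 or fine c = 0 that is added is harmless. *)
apply/eqP; rewrite eq_le; apply/andP; split.
- apply: (gauss_le_up_to_point (r := fine a)) => // z /Sin/andP[].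
  rewrite le_eqVlt => /predU1P[-> _|az zc]; first by right.
  by left; rewrite /= az.
- apply: (gauss_le_up_to_point (r := fine c)) => // z /= /andP[az].
  rewrite le_eqVlt => /predU1P[<-|zc]; first by right.
  by left; apply: inS; rewrite az.
Qed.

End gaussian_intervals.

(** * Gaussian mass of the preimage of a cell under one Euler step *)

Section euler_step.
Context {R : realType}.
Local Notation gauss := (normal_prob (0 : R) 1).

Lemma standardize_pos (m v z : R) (y : \bar R) : 0 < v ->
  (((y - m%:E) * v^-1%:E <= z%:E)%E = (y <= (m + v * z)%:E)%E) *
  ((z%:E <= (y - m%:E) * v^-1%:E)%E = ((m + v * z)%:E <= y)%E).
Proof.
move=> v0; rewrite lee_pdivrMr// lee_pdivlMr// leeBlDr// leeBrDr//.
by rewrite -EFinM -EFinD [z * v]mulrC [_ + m]addrC.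
Qed.

Lemma standardize_neg (m v z : R) (y : \bar R) : v < 0 ->
  (((y - m%:E) * v^-1%:E <= z%:E)%E = ((m + v * z)%:E <= y)%E) *
  ((z%:E <= (y - m%:E) * v^-1%:E)%E = (y <= (m + v * z)%:E)%E).
Proof.
move=> v0; rewrite lee_ndivrMr// lee_ndivlMr// leeBlDr// leeBrDr//.
by rewrite -EFinM -EFinD [z * v]mulrC [_ + m]addrC.
Qed.

Context (D : R) (b sigma : R -> R -> R) (k : nat) (xi : R).

Lemma measurable_euler_preimage (A : set R) :
  measurable A -> measurable (euler_op D b sigma k xi @^-1` A).
Proof.
move=> mA; rewrite -[X in measurable X]setTI.
have : measurable_fun setT (euler_op D b sigma k xi).
  by apply: measurable_funD => //; apply: measurable_funM.
exact.
Qed.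

Context (N : nat) (x : N.-tuple R) (C : 'I_N -> set R).
Context (xs : sorted <%R x) (vor : voronoi_partition x C).

Lemma gauss_cell_pos (j : 'I_N) : 0 < euler_scale D sigma k xi ->
  gauss (euler_op D b sigma k xi @^-1` C j) =
  (Phi0 (x_plus D b sigma k x j xi) - Phi0 (x_minus D b sigma k x j xi))%:E.
Proof.
move=> v0; apply: gauss_between.
- by apply: measurable_euler_preimage; case: vor.
- rewrite /x_plus /x_minus lee_pmul2r ?lte_fin ?invr_gt0//.
  by rewrite leeB// lower_mid_le_upper_mid.
- move=> z; rewrite !ltNge !standardize_pos// -!ltNge.
  exact: sub_voronoi_cell.
- by move=> z; rewrite !standardize_pos//; exact: voronoi_cell_sub.
Qed.

(** A negative scale reverses the order, so that the lower midpoint becomes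
  the upper endpoint in the variable z. *)
Lemma gauss_cell_neg (j : 'I_N) : euler_scale D sigma k xi < 0 ->
  gauss (euler_op D b sigma k xi @^-1` C j) =
  (Phi0 (x_minus D b sigma k x j xi) - Phi0 (x_plus D b sigma k x j xi))%:E.
Proof.
move=> v0; apply: gauss_between.
- by apply: measurable_euler_preimage; case: vor.
- rewrite /x_plus /x_minus lee_ndivrMr//.
  rewrite -muleA -EFinM mulVf ?lt_eqF// mule1.
  by rewrite leeB// lower_mid_le_upper_mid.
- move=> z; rewrite !ltNge !standardize_neg// -!ltNge andbC.
  exact: sub_voronoi_cell.
- by move=> z; rewrite !standardize_neg// andbC; exact: voronoi_cell_sub.
Qed.

End euler_step.

(** * Independence of the quantized scheme from the later noises *)

Section quantized_scheme.
Context {d : measure_display} {T : measurableType d} {R : realType}.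
Context (P : probability T R).

Lemma probability_partition (N : nat) (F : 'I_N -> set T) (A : set T) :
  (forall i, measurable (F i)) -> trivIset setT F -> \bigcup_i F i = setT ->
  measurable A -> P A = (\sum_(i < N) P (A `&` F i))%E.
Proof.
move=> mF tF FT mA; rewrite -{1}(setIT A) -FT setI_bigcupr.
have -> : \bigcup_i (A `&` F i) = \big[setU/set0]_(i < N) (A `&` F i).
  rewrite -(bigcup_pred (@predT 'I_N)); congr bigcup.
  by apply/seteqP; split.
apply: measure_bigsetU_ord => [i|]; first exact: measurableI.
exact: trivIset_setIl.
Qed.

Lemma measurable_RV_preimage (X : {RV P >-> R}) (A : set R) :
  measurable A -> measurable (X @^-1` A).
Proof.
by move=> mA; rewrite -[X in measurable X]setTI; exact: measurable_funPT.
Qed.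

Lemma sigma_of_family_bigcap (I : set nat) (Z : nat -> {RV P >-> R})
    (s : seq nat) (B : nat -> set R) :
  [set` s] `<=` I -> (forall i, measurable (B i)) ->
  sigma_of_family I Z (\bigcap_(i in [set` s]) Z i @^-1` B i).
Proof.
move=> sI mB; pose G : set (set T) :=
  [set E | exists i B, [/\ I i, measurable B & E = Z i @^-1` B]].
(* Membership in the generated sigma-algebra is measurability for the
   measurable structure that it defines on T, where the general closure lemmas
   apply. *)
suff : measurable (\bigcap_(i in [set` s]) Z i @^-1` B i :
  set (g_sigma_algebraType G)) by [].
apply: fin_bigcap_measurable => [|i si]; first exact: finite_seq.
by apply: sub_sigma_algebra; exists i, (B i); split => //; exact: sI.
Qed.

Context (n : nat) (D : R) (b sigma : R -> R -> R).
Context (X0 : {RV P >-> R}) (Z : nat -> {RV P >-> R}).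
Context (N : nat -> nat) (x : forall k, (N k).-tuple R).
Context (C : forall k, 'I_(N k) -> set R).
Context (vor : forall l, (l <= n)%N -> voronoi_partition (x l) (@C l)).

Local Notation Xt := (Xtilde D b sigma x C X0 (fun i => Z i : T -> R)).
Local Notation cell l i := (Xt l @^-1` @C l i).

Lemma preimage_Xtilde_succ (l : nat) (i : 'I_(N l)) (A : set R) :
  (l <= n)%N ->
  Xt l.+1 @^-1` A `&` cell l i =
  cell l i `&` Z l.+1 @^-1` (euler_op D b sigma l (tnth (x l) i) @^-1` A).
Proof.
move=> ln; rewrite setIC; apply/seteqP; split => w [Ci] /=;
  by rewrite (proj_grid_cell (vor ln) Ci).
Qed.

Lemma cell_cover (l : nat) : (l <= n)%N -> \bigcup_i cell l i = setT.
Proof. by move=> /vor[_ _ CT _]; rewrite -preimage_bigcup CT. Qed.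

Lemma cell_trivIset (l : nat) : (l <= n)%N ->
  trivIset setT (fun i => cell l i).
Proof.
move=> /vor[_ tC _ _] i j _ _ [w [Ci Cj]].
by apply: tC => //; exists (Xt l w).
Qed.

(** The coefficients enter only through their values at the finitely many grid
  points, and for each of them the step is an affine function of the noise. *)
Lemma measurable_Xtilde (l : nat) (A : set R) : (l <= n)%N ->
  measurable A -> measurable (Xt l @^-1` A).
Proof.
elim: l A => [|l IH] A ln mA; first exact: measurable_RV_preimage.
have ln' := ltnW ln.
rewrite -(setIT (_ @^-1` _)) -(cell_cover ln') setI_bigcupr.
apply: fin_bigcup_measurable => [|i _]; first exact: finite_finset.
rewrite preimage_Xtilde_succ//; apply: measurableI.
  by apply: IH => //; case: (vor ln').
by apply: measurable_RV_preimage; exact: measurable_euler_preimage.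
Qed.

Context (Zind : mutually_independent [set i | (1 <= i <= n)%N] Z).
Context (X0ind : independent_of_family X0 [set i | (1 <= i <= n)%N] Z).

(** At time l+1, each cell at time l contributes an event about the state at
  time l and the noises l+1 and s; the induction hypothesis for the family
  l+1 :: s factors it. The factor of the noises s comes out of the sum over the
  cells, and what remains is the case where s is empty, that is, the
  probability of the event at time l+1. *)
Lemma Xtilde_indep (l : nat) (s : seq nat) (A : set R) (B : nat -> set R) :
  (l <= n)%N -> uniq s -> {in s, forall i, (l < i <= n)%N} ->
  measurable A -> (forall i, measurable (B i)) ->
  P (Xt l @^-1` A `&` \bigcap_(i in [set` s]) Z i @^-1` B i) =
  (P (Xt l @^-1` A) * \prod_(i <- s) P (Z i @^-1` B i))%E.
Proof.
elim: l s A B => [|l IH] s A B ln us sn mA mB.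
  have sI : [set` s] `<=` [set i | (1 <= i <= n)%N] by move=> i /sn.
  by rewrite X0ind// ?Zind//; exact: sigma_of_family_bigcap.
have ln' := ltnW ln.
pose E i := euler_op D b sigma l (tnth (x l) i) @^-1` A.
have mC (i : 'I_(N l)) : measurable (C i) by case: (vor ln').
have mE i : measurable (E i) by exact: measurable_euler_preimage.
have key (s' : seq nat) : uniq s' -> {in s', forall i, (l.+1 < i <= n)%N} ->
    P (Xt l.+1 @^-1` A `&` \bigcap_(i in [set` s']) Z i @^-1` B i) =
    ((\sum_(i < N l) P (cell l i) * P (Z l.+1 @^-1` E i)) *
      \prod_(i <- s') P (Z i @^-1` B i))%E.
  move=> us' sn'.
  have ls' : l.+1 \notin s' by apply/negP => /sn'; rewrite ltnn.
  rewrite (probability_partition (F := fun i => cell l i)); last 4 first.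
  - by move=> i; exact: measurable_Xtilde.
  - exact: cell_trivIset.
  - exact: cell_cover.
  - apply: measurableI; first exact: measurable_Xtilde.
    apply: fin_bigcap_measurable => [|i _]; first exact: finite_seq.
    exact: measurable_RV_preimage.
  rewrite ge0_sume_distrl; last by move=> i _; rewrite mule_ge0.
  apply: eq_bigr => i _.
  pose B' (j : nat) := if j == l.+1 then E i else B j.
  have B's j : j \in s' -> B' j = B j.
    by move=> js; rewrite /B'; case: eqP js ls' => // -> ->.
  rewrite setIAC preimage_Xtilde_succ// -setIA.
  rewrite (_ : _ `&` \bigcap_(_ in _) _ =
      \bigcap_(j in [set` l.+1 :: s']) Z j @^-1` B' j); last first.
    rewrite !bigcap_seq big_cons {1}/B' eqxx; congr (_ `&` _).
    by apply: eq_big_seq => j /B's ->.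
  rewrite (IH (l.+1 :: s') (C i) B')//; last 3 first.
  - by rewrite /= ls'.
  - move=> j; rewrite inE => /predU1P[->|/sn'/andP[/ltnW -> ->//]].
    by rewrite ltnSn.
  - by move=> j; rewrite /B'; case: ifP.
  rewrite big_cons {1}/B' eqxx muleA; congr (_ * _)%E.
  by apply: eq_big_seq => j /B's ->.
rewrite key//; congr (_ * _)%E.
have := key [::] isT; rewrite big_nil mule1 => <- //.
by rewrite bigcap_seq big_nil setIT.
Qed.

(** * Transition probabilities and marginal law *)

Lemma Xtilde_step (l : nat) (i : 'I_(N l)) (A : set R) : (l < n)%N ->
  measurable A ->
  P (Xt l.+1 @^-1` A `&` cell l i) =
  (P (cell l i) * distribution P (Z l.+1)
     (euler_op D b sigma l (tnth (x l) i) @^-1` A))%E.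
Proof.
move=> ln mA; rewrite preimage_Xtilde_succ 1?ltnW//.
have := @Xtilde_indep l [:: l.+1] (C i)
  (fun=> euler_op D b sigma l (tnth (x l) i) @^-1` A).
rewrite bigcap_seq !big_seq1; apply => //.
- exact: ltnW.
- by move=> j; rewrite inE => /eqP ->; rewrite ltnSn.
- by case: (vor (ltnW ln)).
- by move=> _; exact: measurable_euler_preimage.
Qed.

Lemma transition_formulas (l : nat) (A : set R) (q : 'I_(N l) -> R) :
  (l < n)%N -> measurable A ->
  (forall i, distribution P (Z l.+1)
     (euler_op D b sigma l (tnth (x l) i) @^-1` A) = (q i)%:E) ->
  (forall i, (0 < P (cell l i))%E ->
     cond_prob P (Xt l.+1 @^-1` A) (cell l i) = q i) /\
  fine (P (Xt l.+1 @^-1` A)) = \sum_(i < N l) fine (P (cell l i)) * q i.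
Proof.
move=> ln mA qE.
have mcell i : measurable (cell l i).
  by apply: measurable_Xtilde; [exact: ltnW|case: (vor (ltnW ln))].
have fcell i : P (cell l i) \is a fin_num by exact: fin_num_measure.
split => [i Pi|].
  rewrite /cond_prob Xtilde_step// qE fineM// mulrAC mulfV ?mul1r//.
  by rewrite gt_eqF// fine_gt0// Pi ltey_eq fcell.
rewrite (probability_partition (F := fun i => cell l i))//; last 3 first.
- by apply: cell_trivIset; exact: ltnW.
- by apply: cell_cover; exact: ltnW.
- exact: measurable_Xtilde.
rewrite -sum_fine => [|i _]; last by rewrite Xtilde_step// qE fin_numM.
by apply: eq_bigr => i _; rewrite Xtilde_step// qE fineM.
Qed.

End quantized_scheme.

Theorem proposition4p1 (R : realType) (d : measure_display)
    (T : measurableType d) (P : probability T R)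
    (hor : R) (n : nat) (b sigma : R -> R -> R)
    (X0 : {RV P >-> R}) (Z : nat -> {RV P >-> R})
    (N : nat -> nat) (x : forall k, (N k).-tuple R)
    (C : forall k, 'I_(N k) -> set R) (k : nat) :
  let D := hor / n%:R in
  let Xt := Xtilde D b sigma x C X0 (fun i => Z i : T -> R) in
  let p (l : nat) (i : 'I_(N l)) : R := fine (P (Xt l @^-1` C l i)) in
  let xp (j : 'I_(N k.+1)) := x_plus D b sigma k (x k.+1) j in
  let xm (j : 'I_(N k.+1)) := x_minus D b sigma k (x k.+1) j in
  0 < hor -> (0 < n)%N ->
  euler_coefficient hor b -> euler_coefficient hor sigma ->
  (forall t, t \in `[0, hor] ->
     forall xi, sigma t xi ^+ 2 \is a GRing.unit) ->
  (X0 : T -> R) \in Lfun P 2%:E ->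
  mutually_independent [set i | (1 <= i <= n)%N] Z ->
  (forall i, (1 <= i <= n)%N ->
     forall A : set R, measurable A ->
       distribution P (Z i) A = normal_prob (0 : R) 1 A) ->
  independent_of_family X0 [set i | (1 <= i <= n)%N] Z ->
  (forall l, (l <= n)%N ->
     [/\ sorted <%R (x l),
         optimal_quantizer P (Xt l) (N l) [set` x l]
       & voronoi_partition (x l) (@C l)]) ->
  (k < n)%N ->
  ((forall xi, 0 < sigma (k%:R * D) xi) ->
     (forall (i : 'I_(N k)) (j : 'I_(N k.+1)),
        (0 < P (Xt k @^-1` C k i))%E ->
        cond_prob P (Xt k.+1 @^-1` C k.+1 j) (Xt k @^-1` C k i) =
          Phi0 (xp j (tnth (x k) i)) - Phi0 (xm j (tnth (x k) i)))
     /\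
     (forall j : 'I_(N k.+1),
        p k.+1 j = \sum_(i < N k) p k i *
          (Phi0 (xp j (tnth (x k) i)) - Phi0 (xm j (tnth (x k) i)))))
  /\
  (* sigma_k is continuous without zero, so this is the only other case. *)
  ((forall xi, sigma (k%:R * D) xi < 0) ->
     (forall (i : 'I_(N k)) (j : 'I_(N k.+1)),
        (0 < P (Xt k @^-1` C k i))%E ->
        cond_prob P (Xt k.+1 @^-1` C k.+1 j) (Xt k @^-1` C k i) =
          Phi0 (xm j (tnth (x k) i)) - Phi0 (xp j (tnth (x k) i)))
     /\
     (forall j : 'I_(N k.+1),
        p k.+1 j = \sum_(i < N k) p k i *
          (Phi0 (xm j (tnth (x k) i)) - Phi0 (xp j (tnth (x k) i))))).
Proof.
move=> D Xt p xp xm hor0 n0 _ _ _ _ Zind Zgauss X0ind grids kn.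
have vor l : (l <= n)%N -> voronoi_partition (x l) (@C l) by move=> /grids[].
have [xs _ vor1] := grids _ kn.
have mC j : measurable (C k.+1 j) by case: vor1.
have sqrtD : 0 < Num.sqrt D by rewrite sqrtr_gt0 divr_gt0// ltr0n.
have formulas (q : 'I_(N k.+1) -> 'I_(N k) -> R) :
    (forall j i, normal_prob (0 : R) 1
       (euler_op D b sigma k (tnth (x k) i) @^-1` C k.+1 j) = (q j i)%:E) ->
    (forall i j, (0 < P (Xt k @^-1` C k i))%E ->
       cond_prob P (Xt k.+1 @^-1` C k.+1 j) (Xt k @^-1` C k i) = q j i) /\
    (forall j, p k.+1 j = \sum_(i < N k) p k i * q j i).
  move=> qE.
  have law j i : distribution P (Z k.+1)
      (euler_op D b sigma k (tnth (x k) i) @^-1` C k.+1 j) = (q j i)%:E.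
    by rewrite Zgauss//; exact: measurable_euler_preimage.
  have tf j := transition_formulas vor Zind X0ind kn (mC j) (law j).
  by split=> [i j|j]; [apply: (tf j).1|exact: (tf j).2].
split=> sgn; apply: formulas => j i.
- by apply: gauss_cell_pos => //; rewrite mulr_gt0.
- by apply: gauss_cell_neg => //; rewrite pmulr_rlt0.
Qed.
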